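(* Let $k\ge1$ be an integer and define the sequence $(r_n)_{n\ge0}$ over $\mathbb{F}_2$ by $r_0=0$ and, for $n\ge1$, $$r_n=\begin{cases} r_{\lfloor n/2\rfloor}+1 & \text{if } n\equiv 2^k-1 \pmod{2^k},\\ r_{\lfloor n/2\rfloor} & \text{otherwise}\end{cases}$$ (the parity of the number of occurrences of the block $11\dots1$ of length $k$ in the binary expansion of $n$; $k=1$ gives the Thue--Morse sequence, $k=2$ the Rudin--Shapiro sequence). Then for every $N\ge1$, $$L(r_n,N)=\begin{cases} 2(2^k-1)\left\lfloor\frac{N}{4(2^k-1)}\right\rfloor+2^k & \text{if } 2^k\le N \bmod 4(2^k-1)\le 3(2^k-1),\\[4pt] 2(2^k-1)\left\lfloor\frac{N+2^k-2}{4(2^k-1)}\right\rfloor & \text{otherwise.}\end{cases}$$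
   Context: The $N$th linear complexity $L(u_n,N)$ of a sequence $(u_n)$ over $\mathbb{F}_2$ is the least $L\ge 0$ such that there exist $c_0,\dots,c_{L-1}\in\mathbb{F}_2$ with $u_{n+L}=c_{L-1}u_{n+L-1}+\dots+c_0u_n$ for all $0\le n\le N-L-1$; by convention $L(u_n,N)=0$ if $u_0=\dots=u_{N-1}=0$, and $L(u_n,N)=N$ if $u_0=\dots=u_{N-2}=0\ne u_{N-1}$. Here $N \bmod 4(2^k-1)$ denotes the least nonnegative residue. *)

(* Defs.v *)
From mathcomp Require Import all_boot all_algebra.

Set Implicit Arguments.
Unset Strict Implicit.
Unset Printing Implicit Defensive.

Import GRing.Theory.
Local Open Scope ring_scope.

(* u_(n+L) = c_(L-1) u_(n+L-1) + ... + c_0 u_n for all 0 <= n <= N - L - 1;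
   the truncated difference (N - L)%N makes the range empty when N <= L. *)
Definition has_recurrence (u : nat -> 'F_2) (N L : nat) : bool :=
  [exists c : {ffun 'I_L -> 'F_2},
     [forall n : 'I_(N - L), u (n + L)%N == \sum_(i < L) c i * u (n + i)%N]].

Lemma has_recurrenceP (u : nat -> 'F_2) (N L : nat) :
  reflect (exists c : 'I_L -> 'F_2, forall n : nat, (n < N - L)%N ->
             u (n + L)%N = \sum_(i < L) c i * u (n + i)%N)
          (has_recurrence u N L).
Proof.
apply: (iffP existsP) => [[c /forallP cP] | [c cP]].
  by exists c => n ltn; apply/eqP/(cP (Ordinal ltn)).
exists (finfun c); apply/forallP => n; apply/eqP; rewrite cP //.
by apply: eq_bigr => i _; rewrite ffunE.
Qed.

Lemma has_recurrence_ex (u : nat -> 'F_2) (N : nat) :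
  exists L, has_recurrence u N L.
Proof.
by exists N; apply/has_recurrenceP; exists (fun=> 0) => n; rewrite subnn.
Qed.

(* The usual conventions for an initial segment 0, ..., 0 or 0, ..., 0, 1 are
   instances of this definition: see linear_complexity0 and
   linear_complexity_last. *)
Definition linear_complexity (u : nat -> 'F_2) (N : nat) : nat :=
  ex_minn (has_recurrence_ex u N).

Lemma linear_complexity0 (u : nat -> 'F_2) (N : nat) :
  (forall n, (n < N)%N -> u n = 0) -> linear_complexity u N = 0%N.
Proof.
move=> u0; rewrite /linear_complexity; case: ex_minnP => L _ minL.
apply/eqP; rewrite -leqn0; apply: minL; apply/has_recurrenceP.
by exists (fun=> 0) => n; rewrite subn0 addn0 big_ord0 => /u0.
Qed.

Lemma linear_complexity_last (u : nat -> 'F_2) (N : nat) :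
  (forall n, (n < N)%N -> u n = 0) -> u N != 0 ->
  linear_complexity u N.+1 = N.+1.
Proof.
move=> u0 uN; rewrite /linear_complexity; case: ex_minnP => L recL minL.
apply/eqP; rewrite eqn_leq minL /=; last first.
  by apply/has_recurrenceP; exists (fun=> 0) => n; rewrite subnn.
rewrite leqNgt; apply/negP => ltLN; have leLN : (L <= N)%N by [].
have [c cP] := has_recurrenceP _ _ _ recL.
have := cP (N - L)%N; rewrite subSn // ltnSn subnK // => /(_ isT) uNE.
case/negP: uN; rewrite uNE big1 // => i _; rewrite u0 ?mulr0 //.
by rewrite -[ltnRHS](subnK leLN) ltn_add2l.
Qed.

(* The fuel m is a bound on n; block_parityE is the intended recursion. *)
Fixpoint block_parity_rec (k m n : nat) : 'F_2 :=
  if m is m'.+1 then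
    if n == 0%N then 0
    else if n == (2 ^ k - 1)%N %[mod 2 ^ k]
         then block_parity_rec k m' (n %/ 2) + 1
         else block_parity_rec k m' (n %/ 2)
  else 0.

(* Parity of the number of occurrences of the block 1...1 of length k in the
   binary expansion of n. *)
Definition block_parity (k n : nat) : 'F_2 := block_parity_rec k n n.

Lemma block_parity0 (k : nat) : block_parity k 0 = 0.
Proof. by []. Qed.

Lemma block_parityE (k n : nat) : (1 <= n)%N ->
  block_parity k n = if n == (2 ^ k - 1)%N %[mod 2 ^ k]
                     then block_parity k (n %/ 2) + 1
                     else block_parity k (n %/ 2).
Proof.
have recE m1 m2 p : (p <= m1)%N -> (p <= m2)%N ->
    block_parity_rec k m1 p = block_parity_rec k m2 p.
  elim: m1 m2 p => [|m1 IH] [|m2] [|p] //= le1 le2.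
  have half_le m : (p < m.+1 -> p.+1 %/ 2 <= m)%N.
    by move=> lepm; rewrite -ltnS (leq_trans (ltn_Pdiv _ _)).
  by rewrite (IH m2) ?half_le.
case: n => // n _; rewrite /block_parity /=.
by rewrite (recE n (n.+1 %/ 2)%N) // -ltnS ltn_Pdiv.
Qed.

(* Main.v *)
Require Import Defs.
From mathcomp Require Import all_boot all_algebra.
From mathcomp Require Import ring zify.

(* Over F_2 the generating series G of r satisfies G = (1 + x) G^2 + E with
   (1 + x)^(2^k) E = x^(2^k - 1), so that h = (1 + x) G is a root of
   h^2 + h + 1/t, where t = ((1 + x) / x)^M and M = 2^k - 1. Hence h has the
   continued fraction [0; t + 1, t, t, ...], and clearing denominators in its
   i-th convergent (dropping the common factor 1 + x when i is even) gives a
   connection polynomial of length M i + (i mod 2) for r whose first failure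
   occurs exactly at index M (2 i + 1). The order of the error Q h + P is read
   off its norm (Q h + P) (Q h + P + Q). By Massey's lemma these exact failures
   determine the complexity profile. *)

Set Implicit Arguments.
Unset Strict Implicit.
Unset Printing Implicit Defensive.

Import GRing.Theory.
Local Open Scope ring_scope.

(** * Divisibility by powers of the indeterminate *)

Section PolyModXn.
Variable F : fieldType.
Implicit Types p q : {poly F}.

Lemma dvdXnP n p : reflect (forall i, (i < n)%N -> p`_i = 0) ('X^n %| p).
Proof.
have takeE : 'X^n %| p = (take_poly n p == 0).
  by rewrite Pdiv.IdomainMonic.take_poly_modp.
rewrite takeE; apply: (iffP eqP) => [p0 i lti | p0].
  by have := coef_take_poly n p i; rewrite lti p0 coef0.
by apply/polyP => i; rewrite coef_take_poly coef0; case: ifP => // /p0.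
Qed.

Lemma coprime_Xn n p : p`_0 != 0 -> coprimep 'X^n p.
Proof.
move=> p0; rewrite coprimep_expl // coprimep_sym -['X]subr0 -polyC0.
by rewrite coprimep_XsubC rootE horner_coef0.
Qed.

(** A factor with constant term 1 is a unit modulo x^(m+1), and multiplying by it leaves the lowest
    term x^m unchanged there. *)
Lemma dvdXn_unit m p q : q`_0 = 1 ->
  'X^(m.+1) %| p * q - 'X^m -> 'X^(m.+1) %| p - 'X^m.
Proof.
move=> q0 dv; have/Gauss_dvdpl <- : coprimep 'X^(m.+1) q.
  by rewrite coprime_Xn // q0 oner_neq0.
have -> : (p - 'X^m : {poly F}) * q = (p * q - 'X^m) - (q - 1) * 'X^m by ring.
rewrite dvdp_sub // exprS dvdp_mul // -['X]expr1; apply/dvdXnP => -[] // _.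
by rewrite coefB coef1 q0 subrr.
Qed.

End PolyModXn.

(** * Linear recurrences as congruences; Massey's lemma *)

Definition trunc_series (u : nat -> 'F_2) (B : nat) : {poly 'F_2} :=
  \poly_(n < B) u n.

Lemma coef_mul_trunc u B L (C : {poly 'F_2}) n :
  C`_0 = 1 -> (size C <= L.+1)%N -> (n + L < B)%N ->
  (C * trunc_series u B)`_(n + L) =
    u (n + L)%N + \sum_(i < L) C`_(L - i) * u (n + i)%N.
Proof.
move=> C0 szC ltB.
have -> : (C * trunc_series u B)`_(n + L) =
    \sum_(j < L.+1) C`_j * u (n + L - j)%N.
  rewrite coefM (big_ord_widen (n + L).+1 (fun j => C`_j * u (n + L - j)%N)).
    rewrite [RHS]big_mkcond; apply: eq_bigr => j _ /=; rewrite coef_poly.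
    rewrite (leq_ltn_trans (leq_subr _ _) ltB); case: ifP => // /negbT.
    by rewrite -leqNgt => leLj; rewrite nth_default ?mul0r // (leq_trans szC).
  by rewrite ltnS leq_addl.
rewrite big_ord_recl C0 mul1r subn0; congr (_ + _).
rewrite (reindex_inj rev_ord_inj); apply: eq_bigr => i _ /=.
by rewrite /bump /= add1n subnSK //; congr (_ * u _); have := ltn_ord i; lia.
Qed.

(** [C] is the reciprocal of the characteristic polynomial; [P] absorbs the coefficients below [L],
    on which the recurrence imposes nothing. *)
Lemma has_recurrence_polyP (u : nat -> 'F_2) N L B : (N <= B)%N ->
  reflect (exists C P : {poly 'F_2}, [/\ C`_0 = 1, (size C <= L.+1)%N,
              (size P <= L)%N & 'X^N %| C * trunc_series u B - P])
          (has_recurrence u N L).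
Proof.
move=> leNB; apply: (iffP (has_recurrenceP _ _ _)) => [[c cP]|[C [P]]].
  (* [C] is 1 - c_(L-1) x - ... - c_0 x^L; the default 0 is never reached, as 0 < j <= L gives L - j
     < L. *)
  pose C : {poly 'F_2} := \poly_(j < L.+1)
    if (0 < j)%N then - oapp c 0 (insub (L - j)%N) else 1.
  have C0 : C`_0 = 1 by rewrite coef_poly.
  have szC : (size C <= L.+1)%N by apply: size_poly.
  exists C, (take_poly L (C * trunc_series u B)).
  split=> //; first exact: size_take_poly.
  apply/dvdXnP => i ltiN; rewrite coefB coef_take_poly.
  case: ltnP => [|leLi]; first by rewrite subrr.
  rewrite subr0 -(subnK leLi) coef_mul_trunc //; last first.
    by rewrite subnK // (leq_trans ltiN).
  rewrite cP ?ltn_sub2r ?(leq_ltn_trans leLi) // -big_split big1 // => j _.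
  rewrite /C coef_poly ltnS leq_subr subn_gt0 ltn_ord.
  by rewrite subKn ?(ltnW (ltn_ord j)) //= valK /= mulNr subrr.
case=> C0 szC szP /dvdXnP dv; exists (fun i => C`_(L - i)) => n ltn.
have ltN : (n + L < N)%N by lia.
have := dv _ ltN; rewrite coefB coef_mul_trunc // ?(leq_trans ltN) //.
rewrite [P`__]nth_default ?subr0 ?(leq_trans szP) ?leq_addl //.
move/eqP; rewrite addr_eq0 => /eqP ->.
by rewrite oppr_pchar2 // pchar_Fp.
Qed.

(* [D] is a reciprocal connection polynomial of length [d] for [u 0 .. u (m-1)],
   with discrepancy 1 at index [m]; truncating at every [B > m] replaces power
   series. *)
Definition exact_annihilator (u : nat -> 'F_2) (d m : nat) : Prop :=
  forall B, (m < B)%N -> exists D P : {poly 'F_2},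
    [/\ D`_0 = 1, (size D <= d.+1)%N, (size P <= d)%N
      & 'X^(m.+1) %| D * trunc_series u B - P - 'X^m].

Lemma exact_annihilator_recurrence u d m N :
  exact_annihilator u d m -> (N <= m)%N -> has_recurrence u N d.
Proof.
move=> /(_ _ (ltnSn m)) [D [P [D0 szD szP dv]]] leNm.
apply/(@has_recurrence_polyP _ _ _ m.+1); first exact: leqW.
exists D, P; split=> //.
rewrite -[_ - P](subrK 'X^m) dvdp_add ?dvdp_exp2l //.
by apply: dvdp_trans dv; rewrite dvdp_exp2l // leqW.
Qed.

(* Massey's lemma: eliminating the series between the two relations leaves a
   polynomial of degree below [L + d] with nonzero coefficient at 'X^m. *)
Lemma exact_annihilator_leq u d m N L :
  exact_annihilator u d m -> (m < N)%N -> has_recurrence u N L ->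
  (m < L + d)%N.
Proof.
move=> annD ltmN /(has_recurrence_polyP _ _ (leqnn N)) [C [P [C0 szC szP dvC]]].
have [D [R [D0 szD szR dvD]]] := annD _ ltmN.
rewrite ltnNge; apply/negP => leLd.
have: 'X^(m.+1) %| D * P - C * R - C * 'X^m.
  pose G := trunc_series u N.
  have -> : D * P - C * R - C * 'X^m =
      C * (D * G - R - 'X^m) - D * (C * G - P) by ring.
  rewrite dvdp_sub // dvdp_mull //.
  by apply: dvdp_trans dvC; rewrite dvdp_exp2l.
move/dvdXnP/(_ m (ltnSn m))/eqP; rewrite !coefB coefMXn ltnn subnn C0.
rewrite !nth_default ?sub0r ?subr0 ?oppr_eq0 ?oner_eq0 //.
- apply: leq_trans (size_polyMleq _ _) _; rewrite -subn1 leq_subLR.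
  by apply: leq_trans (leq_add szC szR) _.
- apply: leq_trans (size_polyMleq _ _) _; rewrite -subn1 leq_subLR.
  by apply: leq_trans (leq_add szD szP) _; rewrite addSn addnC.
Qed.

(** The first annihilator still holds up to [N], so L <= d; the second has failed before [N], so
    Massey's lemma gives L > m' - d' = d - 1. *)
Lemma linear_complexity_eq u d m d' m' N :
  exact_annihilator u d m -> exact_annihilator u d' m' ->
  (m'.+1 = d + d')%N -> (m' < N <= m)%N -> linear_complexity u N = d.
Proof.
move=> annd annd' Em /andP[ltN leN]; rewrite /linear_complexity.
case: ex_minnP => L recL minL; apply/eqP; rewrite eqn_leq.
rewrite minL ?(exact_annihilator_recurrence annd) //=.
by have := exact_annihilator_leq annd' ltN recL; lia.
Qed.

(** * The quadratic equation and the convergents *)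

Lemma sqr_poly_F2 (p : {poly 'F_2}) : p ^+ 2 = p \Po 'X^2.
Proof.
have ch : 2%N \in [pchar {poly 'F_2}] by rewrite pchar_poly pchar_Fp.
elim/poly_ind: p => [|p c IHp]; first by rewrite expr0n comp_poly0.
rewrite comp_polyD comp_polyM comp_polyX comp_polyC -IHp.
rewrite -!(pFrobenius_autE ch) rmorphD rmorphM /= !pFrobenius_autE.
congr (_ + _); rewrite -polyC_exp; congr _%:P.
by apply/eqP; case: c => -[|[|]].
Qed.

Section BlockParity.
Variable k : nat.
Hypothesis k_gt0 : (0 < k)%N.
Let M := (2 ^ k - 1)%N.
Let A : {poly 'F_2} := 1 + 'X.
Let G := trunc_series (block_parity k).

Let MS : M.+1 = (2 ^ k)%N.
Proof. by rewrite /M subn1 prednK ?expn_gt0. Qed.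

Let M_gt0 : (0 < M)%N.
Proof. by rewrite -ltnS MS -{1}(expn0 2) ltn_exp2l. Qed.

Lemma block_parity_half n :
  block_parity k n = block_parity k (n %/ 2) + (n == M %[mod M.+1])%:R.
Proof.
case: n => [|n]; last first.
  by rewrite block_parityE // -/M -MS; case: ifP; rewrite ?addr0.
by rewrite div0n block_parity0 add0r mod0n modn_small // eq_sym eqn0Ngt M_gt0.
Qed.

(* The series [h = (1 + 'X) G] is a root of [h^2 + h + b / a], where
   [a = (1 + 'X)^M] and [b = 'X^M]. *)
Lemma block_parity_quadratic B :
  'X^B %| A ^+ M * ((A * G B) ^+ 2 + A * G B) - 'X^M.
Proof.
have ch : 2%N \in [pchar {poly 'F_2}] by rewrite pchar_poly pchar_Fp.
pose E : {poly 'F_2} := \poly_(n < B) (n == M %[mod M.+1])%:R.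
(* As G^2 = G(x^2), the factor 1 + x copies r_j to the indices 2j and 2j + 1. *)
have dvG : 'X^B %| G B - A * G B ^+ 2 - E.
  apply/dvdXnP => n ltnB; rewrite !coefB.
  have -> : (A * G B ^+ 2)`_n = block_parity k (n %/ 2).
    rewrite mulrDl mul1r coefD coefXM sqr_poly_F2 !coef_comp_poly_Xn //.
    rewrite !coef_poly !dvdn2; case: n ltnB => [|n] ltnB /=.
      by rewrite div0n ltnB addr0.
    rewrite !divn2 if_neg; case: ifP => on /=; rewrite ?addr0 ?add0r.
      rewrite ifT; last by lia.
      congr block_parity; lia.
    by rewrite ifT //; lia.
  by rewrite !coef_poly ltnB block_parity_half; ring.
(* [E] truncates x^M / (1 + x^(M+1)); as M + 1 = 2^k, Frobenius turns the denominator into (1 +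
   x)^(M+1). *)
have dvE : 'X^B %| A ^+ M.+1 * E - 'X^M.
  have -> : A ^+ M.+1 = 1 + 'X^(M.+1).
    rewrite MS; elim: k => [|j IHj]; first by rewrite expr1.
    by rewrite expnSr exprM IHj -(pFrobenius_autE ch) rmorphD rmorph1 /=
               pFrobenius_autE -exprM.
  apply/dvdXnP => n ltnB; rewrite mulrDl mul1r coefB coefD coefXnM coefXn.
  rewrite !coef_poly ltnB; case: ltnP => [ltnM|leMn].
    by rewrite addr0 !modn_small // subrr.
  rewrite (leq_ltn_trans (leq_subr _ _) ltnB) (gtn_eqF leMn) subr0.
  by rewrite -{1}(subnK leMn) modnDr addrr_pchar2 // pchar_Fp.
(* The doubled term is zero in characteristic 2; with it the identity holds in any commutative
   ring. *)
have -> : A ^+ M * ((A * G B) ^+ 2 + A * G B) - 'X^M =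
   A ^+ M.+1 * (G B - A * G B ^+ 2 - E) + (A ^+ M.+1 * E - 'X^M)
   + (A ^+ M * (A * G B) ^+ 2) *+ 2.
  by rewrite [A ^+ M.+1]exprS; ring.
by rewrite mulrn_pchar // addr0 dvdp_add // dvdp_mull.
Qed.

(* [(P, Q)] such that [Q h + P = b^i h (t h + 1)^i], with [t = a / b] and [h] a
   root of [h^2 + h + 1 / t]; [P / Q] is the [i]-th convergent of [h]. *)
Fixpoint convergent i : {poly 'F_2} * {poly 'F_2} :=
  if i is j.+1 then
    let: (P, Q) := convergent j in
    ('X^M * (P + Q), (A ^+ M + 'X^M) * Q + A ^+ M * P)
  else (0, 1).

(** The left side is a times the norm of Q h + P. Since t h + 1 has norm 1, each step multiplies it
    by b^2. *)
Lemma convergent_norm i : let: (P, Q) := convergent i in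
  A ^+ M * (P ^+ 2 + P * Q) + 'X^M * Q ^+ 2 = 'X^(M * i.*2.+1).
Proof.
have ch : 2%N \in [pchar {poly 'F_2}] by rewrite pchar_poly pchar_Fp.
elim: i => [|i]; first by rewrite muln1 /=; ring.
have -> : 'X^(M * i.+1.*2.+1) = 'X^M ^+ 2 * 'X^(M * i.*2.+1) :> {poly 'F_2}.
  by rewrite doubleS [in LHS]mulnS [in LHS]mulnS addnA addnn -muln2 exprD exprM.
rewrite /=; case: (convergent i) => P Q /= <-.
set a := A ^+ M; set b := 'X^M.
rewrite -[RHS]addr0 -(mulrn_pchar ch
  (a ^+ 2 * b * (P + Q) ^+ 2 + a * b ^+ 2 * (P + Q) * Q
   + a * b ^+ 2 * (P * Q + Q ^+ 2))).
ring.
Qed.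

Lemma size_X1 : size A = 2.
Proof. by rewrite /A addrC size_XaddC. Qed.

Lemma size_X1_exp n : size (A ^+ n) = n.+1.
Proof.
have A0 : A != 0 by rewrite -size_poly_eq0 size_X1.
have := size_exp A n; rewrite size_X1 mul1n => szA.
by rewrite -[in RHS]szA prednK // lt0n size_poly_eq0 expf_neq0.
Qed.

Lemma size_convergent i : let: (P, Q) := convergent i in
  (size P <= (M * i).+1)%N /\ (size Q <= (M * i).+1)%N.
Proof.
elim: i => [|i]; first by rewrite /= size_poly0 size_poly1.
rewrite /= mulnS; case: (convergent i) => P Q [szP szQ].
have szM (p q : {poly 'F_2}) : (size p <= M.+1)%N -> (size q <= (M * i).+1)%N ->
    (size (p * q)%R <= (M + M * i).+1)%N.
  move=> szp szq; apply: leq_trans (size_polyMleq _ _) _.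
  by rewrite -subn1 leq_subLR (leq_trans (leq_add szp szq)) // addSn addnS.
have szD (p q : {poly 'F_2}) n : (size p <= n)%N -> (size q <= n)%N ->
    (size (p + q)%R <= n)%N.
  by move=> szp szq; rewrite (leq_trans (size_polyD _ _)) // geq_max szp.
by split; rewrite ?szD ?szM ?szD ?size_polyXn ?size_X1_exp.
Qed.

Lemma convergent_coef0 i : let: (P, Q) := convergent i in P`_0 = 0 /\ Q`_0 = 1.
Proof.
elim: i => [|i]; first by rewrite /= coef0 coef1.
rewrite /=; case: (convergent i) => P Q [P0 Q0].
have X0 : ('X^M : {poly 'F_2})`_0 = 0 by rewrite coefXn eq_sym eqn0Ngt M_gt0.
have A0 : (A ^+ M)`_0 = 1.
  by rewrite -horner_coef0 horner_exp hornerD hornerC hornerX addr0 expr1n.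
by rewrite !(coef0M, coefD) X0 A0 P0 Q0 !(mul0r, mul1r, mulr0, addr0).
Qed.

(** Modulo [A], two steps multiply P by b^2, and P starts at 0. *)
Lemma dvd_convergent i : ~~ odd i -> A %| (convergent i).1.
Proof.
move=> /even_halfK <-; elim: i./2 => [|j]; first by rewrite dvdp0.
rewrite doubleS /=; case: (convergent j.*2) => P Q /= IHj.
have -> : 'X^M * ('X^M * (P + Q) + ((A ^+ M + 'X^M) * Q + A ^+ M * P)) =
   A ^+ M * ('X^M * (P + Q)) + 'X^M ^+ 2 * P + ('X^M ^+ 2 * Q) *+ 2 by ring.
rewrite mulrn_pchar ?pchar_poly ?pchar_Fp // addr0.
rewrite dvdp_add ?(dvdp_mull _ IHj) // dvdp_mulr // -[X in X %| _]expr1.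
by rewrite dvdp_exp2l.
Qed.

(** The conjugate Q h + P + Q has constant term 1, so the whole order of the norm sits in Q h +
    P. *)
Lemma convergent_approx i B : (M * i.*2.+1 < B)%N ->
  let: (P, Q) := convergent i in
  'X^((M * i.*2.+1).+1) %| Q * (A * G B) + P - 'X^(M * i.*2.+1).
Proof.
have ch : 2%N \in [pchar {poly 'F_2}] by rewrite pchar_poly pchar_Fp.
move=> ltB; have := convergent_norm i; have := convergent_coef0 i.
case: (convergent i) => P Q [P0 Q0] normPQ; set h := A * G B.
have h0 : h`_0 = 0.
  by rewrite coef0M coef_poly (leq_ltn_trans _ ltB) // mulr0.
have := block_parity_quadratic B; rewrite -/h; clearbody h => dvh.
apply: (@dvdXn_unit _ _ _ ((Q * h + P + Q) * A ^+ M)).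
  rewrite coef0M !coefD !coef0M h0 P0 Q0 mulr0 !add0r mul1r.
  by rewrite -horner_coef0 horner_exp hornerD hornerC hornerX addr0 expr1n.
have -> : (Q * h + P) * ((Q * h + P + Q) * A ^+ M) - 'X^(M * i.*2.+1) =
    Q ^+ 2 * (A ^+ M * (h ^+ 2 + h) - 'X^M)
    + (A ^+ M * P * Q * h) *+ 2.
  by rewrite -normPQ; ring.
rewrite mulrn_pchar // addr0 dvdp_mull //.
by apply: dvdp_trans dvh; rewrite dvdp_exp2l.
Qed.

(** As h = A G, the connection polynomial is A Q; for even i, [A] divides P and cancels, which
    shortens the length by one. *)
Lemma block_parity_annihilator i :
  exact_annihilator (block_parity k) (M * i + odd i) (M * i.*2.+1).
Proof.
move=> B ltB; have := convergent_approx ltB; have := convergent_coef0 i.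
have := size_convergent i; have := @dvd_convergent i.
case: (convergent i) => P Q /= dvA [szP szQ] [P0 Q0] dv.
have A0 : A`_0 = 1 by rewrite coefD coef1 coefX addr0.
case: (odd i) dvA => [_ | /(_ isT) /dvdpP[R defP]].
  exists (A * Q), (- P); rewrite coef0M A0 Q0 mulr1 size_polyN addn1 szP.
  split=> //; last by rewrite opprK [A * Q]mulrC -mulrA.
  apply: leq_trans (size_polyMleq _ _) _; rewrite size_X1.
  by rewrite add2n ltnS.
exists Q, (- R); rewrite Q0 size_polyN addn0; split=> //.
  have [->|R0] := eqVneq R 0; first by rewrite size_poly0.
  have A_neq0 : A != 0 by rewrite -size_poly_eq0 size_X1.
  by move: szP; rewrite defP size_mul // size_X1 addn2.
rewrite opprK; apply: (dvdXn_unit A0).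
suff -> : (Q * trunc_series (block_parity k) B + R) * A = Q * (A * G B) + P.
  by [].
by rewrite defP /G; ring.
Qed.

(** * The complexity profile *)

Lemma linear_complexity_block_parity N :
  linear_complexity (block_parity k) N =
    (let i := (N + M - 1) %/ (2 * M) in M * i + odd i)%N.
Proof.
(* The quotient i is the index with M (2i - 1) < N <= M (2i + 1), so [N] lies between consecutive
   failures. *)
have := divn_eq (N + M - 1) (2 * M); have := @ltn_pmod (N + M - 1) (2 * M).
rewrite muln_gt0 M_gt0 => /(_ isT); set r := (_ %% _)%N.
case: (_ %/ _)%N => [|j] /= ltr eN.
  apply/eqP; rewrite muln0 -leqn0 /linear_complexity; case: ex_minnP.
  move=> L _; apply.
  have := exact_annihilator_recurrence (@block_parity_annihilator 0).
  by rewrite muln0 muln1; apply; lia.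
apply: (linear_complexity_eq (@block_parity_annihilator j.+1)
                             (@block_parity_annihilator j)).
  by rewrite -!muln2 /=; case: (odd j) => /=; lia.
move: eN; rewrite -!muln2; nia.
Qed.

End BlockParity.

Local Close Scope ring_scope.

Theorem theorem2 (k : nat) (hk : 1 <= k) (N : nat) (hN : 1 <= N) :
  linear_complexity (block_parity k) N =
    if 2 ^ k <= N %% (4 * (2 ^ k - 1)) <= 3 * (2 ^ k - 1)
    then 2 * (2 ^ k - 1) * (N %/ (4 * (2 ^ k - 1))) + 2 ^ k
    else 2 * (2 ^ k - 1) * ((N + 2 ^ k - 2) %/ (4 * (2 ^ k - 1))).
Proof.
rewrite linear_complexity_block_parity //.
have : 0 < 2 ^ k - 1 by rewrite subn_gt0 -{1}(expn0 2) ltn_exp2l.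
have -> : 2 ^ k = (2 ^ k - 1).+1 by rewrite subn1 prednK ?expn_gt0.
rewrite subn1 /=; move: (2 ^ k - 1) => M M_gt0.
have := divn_eq N (4 * M); have := @ltn_pmod N (4 * M).
rewrite muln_gt0 M_gt0 => /(_ isT).
move: (N %/ (4 * M)) (N %% (4 * M)) => j r ltr eN.
have divE x d q s : x = q * d + s -> s < d -> x %/ d = q.
  by move=> -> lts; rewrite divnMDl ?divn_small ?addn0 // (leq_ltn_trans _ lts).
(* With N = 4Mj + r, the index i is 2j + 1 for M < r <= 3M, 2j + 2 for r > 3M and 2j for r <= M; the
   fourth case is contradictory. *)
have [ltMr | leMr] := ltnP M r; have [ler3M | lt3Mr] := leqP r (3 * M) => /=.
- have -> : (N + M - 1) %/ (2 * M) = j.*2.+1.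
    by apply: (divE _ _ _ (r - M - 1)); rewrite -?muln2; nia.
  by rewrite /= odd_double -muln2; nia.
- have -> : (N + M - 1) %/ (2 * M) = j.+1.*2.
    by apply: (divE _ _ _ (r - 3 * M - 1)); rewrite -?muln2; nia.
  have -> : (N + M.+1 - 2) %/ (4 * M) = j.+1.
    by apply: (divE _ _ _ (r - 3 * M - 1)); rewrite -?muln2; nia.
  by rewrite odd_double -muln2; nia.
- have -> : (N + M - 1) %/ (2 * M) = j.*2.
    by apply: (divE _ _ _ (r + M - 1)); rewrite -?muln2; nia.
  have -> : (N + M.+1 - 2) %/ (4 * M) = j.
    by apply: (divE _ _ _ (r + M - 1)); rewrite -?muln2; nia.
  by rewrite odd_double -muln2; nia.
- by nia.
Qed.
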